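(* Let $M \geq 1$ and $d \geq 2$ be integers. If $X \subseteq [0,1)^d$ is constructed from a $d$-dimensional weak $M$-Latin hypercube $\mathcal{H}$, i.e. $X = \frac{1}{M}\mathcal{H}$, then $$ L_2^{\mathrm{per}}(X)^2 - 2^d L_2^{\mathrm{extr}}(X)^2 = \frac{(2M^2+1)^d + (M^2-1)^d - (1+2^d)M^{2d}}{6^d M^2}. $$
   Context: A weak $M$-Latin hypercube of dimension $d$ is a subset $\mathcal{H} \subseteq \{0,1,\dots,M-1\}^d$ such that for any $k \in \{1,\dots,d\}$ and any $m_1,\dots,m_{k-1},m_{k+1},\dots,m_d \in \{0,\dots,M-1\}$ there is exactly one $m_k \in \{0,\dots,M-1\}$ with $(m_1,\dots,m_d) \in \mathcal{H}$. The point set constructed from $\mathcal{H}$ is $X(\mathcal{H}) = \frac1M \mathcal{H} \subseteq [0,1)^d$; it has $M^{d-1}$ points. For $x, y \in [0,1)$ the (periodic) interval is $[x,y) = \{z \in [0,1): x \leq z < y\}$ if $x<y$, and $[x,y) = \{z \in [0,1): x \leq z \text{ or } z < y\}$ if $x \geq y$. For $\mathbf{x} = (x_1,\dots,x_d), \mathbf{y} = (y_1,\dots,y_d) \in [0,1)^d$ put $[\mathbf{x},\mathbf{y}) = \prod_{k=1}^d [x_k,y_k)$ and let $|[\mathbf{x},\mathbf{y})|$ be its Lebesgue measure, i.e. the product over $k$ of $y_k - x_k$ if $x_k<y_k$ and of $1-x_k+y_k$ if $x_k \geq y_k$. For a finite set $X \subseteq [0,1)^d$ with $\#X = N$ the discrepancy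 function is $D_X(\mathbf{x},\mathbf{y}) = \#(X \cap [\mathbf{x},\mathbf{y})) - N\,|[\mathbf{x},\mathbf{y})|$ (not normalized by $N$). The extreme and periodic $L_2$-discrepancies (nonnegative square roots) are given by $$L_2^{\mathrm{extr}}(X)^2 = \int_{[0,1)^d} \int_{\mathbf{y} > \mathbf{x}} D_X(\mathbf{x},\mathbf{y})^2 \, d\mathbf{y}\, d\mathbf{x}, \qquad L_2^{\mathrm{per}}(X)^2 = \int_{[0,1)^d} \int_{[0,1)^d} D_X(\mathbf{x},\mathbf{y})^2 \, d\mathbf{y}\, d\mathbf{x},$$ where in the first integral $\mathbf{y} \in [0,1)^d$ and $\mathbf{y}>\mathbf{x}$ is meant componentwise. *)

(* Defs.v *)
From HB Require Import structures.
From mathcomp Require Import all_boot all_order all_algebra finmap.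
From mathcomp Require Import all_classical all_reals all_analysis.

Set Implicit Arguments.
Unset Strict Implicit.
Unset Printing Implicit Defensive.

Import Order.TTheory GRing.Theory Num.Theory.
Import numFieldNormedType.Exports.

Local Open Scope classical_set_scope.
Local Open Scope ring_scope.

(* R^d, carrying the product of the Borel sigma-algebras of the factors *)
Notation "''RR[' R ]_ d" := (d.-tuple (measurableTypeR R))
  (at level 0, d at level 2, format "''RR[' R ]_ d") : type_scope.

Section lebesgue_measure_on_tuples.
Variable R : realType.

Definition tcons d (p : measurableTypeR R * 'RR[R]_d) : 'RR[R]_(d.+1) :=
  [tuple of p.1 :: p.2].

Definition tuncons d (x : 'RR[R]_(d.+1)) : measurableTypeR R * 'RR[R]_d :=
  (thead x, [tuple of behead x]).

Lemma tconsK d : cancel (@tcons d) (@tuncons d).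
Proof. by move=> [x y]; congr pair; apply/val_inj. Qed.

Lemma measurable_tcons d : measurable_fun [set: _] (@tcons d).
Proof. exact: measurable_cons. Qed.

Lemma measurable_tuncons d : measurable_fun [set: _] (@tuncons d).
Proof.
apply: measurable_fun_pair; first exact: measurable_tnth.
exact: measurable_behead.
Qed.

Section step.
Variables (d : nat) (m : {sigma_finite_measure set 'RR[R]_d -> \bar R}).

Definition lebesgue_step : set 'RR[R]_(d.+1) -> \bar R :=
  pushforward (@lebesgue_measure R \x m)%E (@tcons d).

(* The canonical instances of pushforward (by a measurability proof) and of a
   sigma-finite product are not found by unification, hence the long names. *)
Let pf : {measure set 'RR[R]_(d.+1) -> \bar R} :=
  measure_function_pushforward__canonical__measure_function_Measure
    (@lebesgue_measure R \x m)%E (@measurable_tcons d).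

HB.instance Definition _ := isMeasure.Build _ _ _ lebesgue_step
  (@measure0 _ _ _ pf) (@measure_ge0 _ _ _ pf)
  (@measure_semi_sigma_additive _ _ _ pf).

Lemma lebesgue_step_sigma_finite : sigma_finite [set: _] lebesgue_step.
Proof.
have [F FT mF] := @isSigmaFinite.sigma_finiteT _ _ _ _
  (lebesgue_integral_fubini.measure_function_Measure_isSigmaFinite__to__measure_function_isSigmaFinite
     (@lebesgue_measure R) m).
exists (fun i => @tuncons d @^-1` F i).
  by rewrite -preimage_bigcup -FT preimage_setT.
move=> i; have [mFi Foo] := mF i; split.
  by rewrite -[X in measurable X]setTI; exact: measurable_tuncons.
rewrite /lebesgue_step /pushforward -comp_preimage.
by rewrite (_ : _ \o _ = id)//; apply/funext => p; exact: tconsK.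
Qed.

HB.instance Definition _ := Measure_isSigmaFinite.Build _ _ _ lebesgue_step
  lebesgue_step_sigma_finite.

End step.

Fixpoint lebesgue_tuple d : {sigma_finite_measure set 'RR[R]_d -> \bar R} :=
  match d with
  | 0 => (@dirac _ ('RR[R]_0) [tuple] R : {sigma_finite_measure set _ -> \bar R})
  | d'.+1 => lebesgue_step (lebesgue_tuple d')
  end.

(* Lebesgue measure on R^d is the product of d copies of that on R: it is
   determined by its values on products of Borel sets. *)
Lemma lebesgue_tupleE d (A : 'I_d -> set (measurableTypeR R)) :
  (forall k, measurable (A k)) ->
  lebesgue_tuple d [set x | forall k, A k (tnth x k)]
  = (\prod_(k < d) lebesgue_measure (A k))%E.
Proof.
elim: d A => [|d IHd] A mA.
  by rewrite big_ord0 /= diracE mem_set// => -[].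
rewrite big_ord_recl -(IHd (fun k => A (lift ord0 k)))// /= /lebesgue_step.
rewrite /pushforward -product_measure1E//; last first.
  rewrite (_ : [set _ | _] =
      \bigcap_(k in [set: 'I_d]) ((@tnth _ _)^~ k @^-1` A (lift ord0 k))).
    apply: fin_bigcap_measurable => // k _.
    by rewrite -[X in measurable X]setTI; exact: measurable_tnth.
  by apply/seteqP; split => x /= Ax k; [move=> _; exact: Ax|exact: Ax].
congr (_ _); apply/seteqP; split => -[x y] /= Axy.
  split; first exact: (Axy ord0).
  by move=> k; have := Axy (lift ord0 k); rewrite tnthS.
move=> k; case: (unliftP ord0 k) => [j|] ->; last exact: Axy.1.
by rewrite tnthS; exact: Axy.2.
Qed.

End lebesgue_measure_on_tuples.

Section periodic_boxes.
Variable R : realType.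

Definition unit_cube d : set 'RR[R]_d :=
  [set x | forall k, 0 <= (tnth x k : R) < 1].

Definition cube_above d (x : 'RR[R]_d) : set 'RR[R]_d :=
  [set y | unit_cube y /\ forall k, (tnth x k : R) < tnth y k].

Definition periodic_itv (x y : R) : set R :=
  if x < y then [set z | 0 <= z < 1 /\ x <= z < y]
  else [set z | 0 <= z < 1 /\ (x <= z \/ z < y)].

Definition periodic_box d (x y : 'RR[R]_d) : set 'RR[R]_d :=
  [set z | forall k, periodic_itv (tnth x k) (tnth y k) (tnth z k)].

Definition volume d (A : set 'RR[R]_d) : R := fine (lebesgue_tuple R d A).

Lemma periodic_itv_measure (x y : R) : 0 <= x < 1 -> 0 <= y < 1 ->
  measurable (periodic_itv x y : set (measurableTypeR R)) /\
  lebesgue_measure (periodic_itv x y)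
  = (if x < y then y - x else 1 - x + y)%:E.
Proof.
move=> /andP[x0 x1] /andP[y0 y1]; rewrite /periodic_itv.
case: ltP => xy.
  rewrite (_ : [set _ | _] = [set` `[x, y[]); last first.
    apply/seteqP; split => z /=; rewrite in_itv /=; first by case.
    move=> /andP[xz zy]; rewrite xz zy; split => //.
    by rewrite (le_trans x0 xz) (lt_trans zy y1).
  by split => //; rewrite lebesgue_measure_itv /= lte_fin xy EFinB.
rewrite (_ : [set _ | _] = [set` `[0, y[] `|` [set` `[x, 1[]); last first.
  apply/seteqP; split => z /=; rewrite !in_itv /=.
    by move=> [/andP[-> ->]] [->|->]; [right|left].
  case=> /andP[a b].
    by rewrite a b (lt_trans b y1); split => //; right.
  by rewrite a b (le_trans x0 a); split => //; left.
split; first exact: measurableU.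
rewrite measureU//; last first.
  rewrite -subset0 => z /=; rewrite !in_itv /= => -[/andP[_ zy] /andP[xz _]].
  by have := le_lt_trans (le_trans xy xz) zy; rewrite ltxx.
rewrite /= !lebesgue_measure_itv /= !lte_fin x1.
case: ltP => y00; first by rewrite oppr0 adde0 -EFinB -EFinD addrC.
by rewrite (_ : y = 0) ?add0e ?addr0//; apply/le_anti/andP.
Qed.

Lemma volume_periodic_box d (x y : 'RR[R]_d) :
  unit_cube x -> unit_cube y ->
  volume (periodic_box x y) =
  \prod_(k < d) (let xk := tnth x k : R in let yk := tnth y k : R in
                 if xk < yk then yk - xk else 1 - xk + yk).
Proof.
move=> x01 y01; rewrite /volume.
rewrite (@lebesgue_tupleE R d
  (fun k => periodic_itv (tnth x k) (tnth y k))); last first.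
  by move=> k; exact: (periodic_itv_measure (x01 k) (y01 k)).1.
under eq_bigr do rewrite (periodic_itv_measure (x01 _) (y01 _)).2.
by rewrite prodEFin.
Qed.

End periodic_boxes.
Arguments unit_cube R d : clear implicits.

Section discrepancy.
Variables (R : realType) (d : nat).
Implicit Type X : set 'RR[R]_d.

(* meaningful for finite X only: fset_set sends an infinite set to fset0 *)
Definition card_of X : nat := #|` fset_set X |.

Definition discrepancy X (x y : 'RR[R]_d) : R :=
  (card_of (X `&` periodic_box x y))%:R
  - (card_of X)%:R * volume (periodic_box x y).

Local Notation mu := (lebesgue_tuple R d).

Definition L2_extr X : R := Num.sqrt (fine (
  \int[mu]_(x in unit_cube R d) \int[mu]_(y in cube_above x)
      ((discrepancy X x y) ^+ 2)%:E)%E).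

Definition L2_per X : R := Num.sqrt (fine (
  \int[mu]_(x in unit_cube R d) \int[mu]_(y in unit_cube R d)
      ((discrepancy X x y) ^+ 2)%:E)%E).

End discrepancy.

(* The k-th coordinate of m is overwritten by j, so that quantifying over m
   amounts to quantifying over the remaining d - 1 coordinates. *)
Definition weak_latin_hypercube M d (H : {set d.-tuple 'I_M}) : Prop :=
  forall (k : 'I_d) (m : d.-tuple 'I_M),
    exists! j : 'I_M, [tuple if i == k then j else tnth m i | i < d] \in H.

Definition latin_points (R : realType) M d (H : {set d.-tuple 'I_M}) :
    set 'RR[R]_d :=
  [set [tuple (tnth m i)%:R / M%:R | i < d] | m in [set` H]].
Arguments latin_points R {M d} H.

(* Main.v *)
Require Import Defs.
From mathcomp Require Import all_boot all_order all_algebra finmap.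
From mathcomp Require Import all_classical all_reals all_analysis.
From mathcomp Require Import measurable_realfun ring lra.

(** Why the theorem is true.

    Let [N] be the number of points. Expanding the square of the discrepancy
    and integrating coordinate by coordinate turns both discrepancies into
    sums over pairs of points. Weight the periodic integral by 1 and the
    extreme integral by twice the indicator of [x < y] in every coordinate
    (which accounts for the factor [2 ^ d]); then each side has the shape

      sum_(p, q) prod_k K (p_k, q_k) - 2 N sum_p prod_k s (p_k) + N^2 l^d.

    With [gap p q = |p - q| (1 - |p - q|)] and [a p = p (1 - p)], the
    one-dimensional integrals are

      periodic:  K = 1/2 - gap p q,         s = 1/3,   l = 1/3;
      extreme:   K = a p + a q - gap p q,   s = a p,   l = 1/6.

    Write [mu = (M^2 - 1) / (6 M^2)]. This is the mean of [a] over the lattice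
    of the multiples of [1/M], and also the mean of [gap p] over it for every
    lattice point [p], since [gap p q = a (p - q mod 1)]. So both kernels have
    the same doubly centred part [w = mu - gap], and they decompose as

      periodic:  K = (1/2 - mu) + w,
      extreme:   K = mu + (a p - mu) + (a q - mu) + w.

    A Latin hypercube is equidistributed in any [d - 1] coordinates. Hence a
    sum over it of a product of functions of single coordinates only sees the
    full product of the centred factors and the product of the means
    ([sum_latin_prod]); applied to [p] and then to [q], this evaluates the
    pair sums ([sum2_latin_prod]). The unknown term
    [sum_(p, q) prod_k w (p_k, q_k)] is common to both sides and cancels. The
    other unknown, [sum_p prod_k (a (p_k) - mu)], comes from the extreme pair
    sum with coefficient [2 N] and from the single sum with coefficient
    [- 2 N]. What remains is

      N^2 ((1/2 - mu)^d + mu^d - (1/3)^d - (1/6)^d),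

    and [N = M^(d - 1)]. *)

Set Implicit Arguments.
Unset Strict Implicit.
Unset Printing Implicit Defensive.

Import Order.TTheory GRing.Theory Num.Theory.
Import numFieldNormedType.Exports.

Local Open Scope classical_set_scope.
Local Open Scope ring_scope.

(** * Sums over a Latin hypercube *)

Section latin_sums.
Variables (R : numFieldType) (M d : nat) (H : {set d.-tuple 'I_M}).
Hypothesis latinH : weak_latin_hypercube H.
Implicit Types (k : 'I_d) (m : d.-tuple 'I_M) (j : 'I_M).

Let overwrite k m j := [tuple if i == k then j else tnth m i | i < d].

Let overwriteE k m j i :
  tnth (overwrite k m j) i = if i == k then j else tnth m i.
Proof. by rewrite tnth_mktuple. Qed.

(** The map that exchanges the k-th coordinate of a tuple with a separate value
    is an involution of (tuple, value) pairs; by the Latin property each tuple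
    has exactly one value sending it into [H]. Counting pairs whose image lies
    in [H] in two ways gives the equidistribution in the other coordinates. *)
Lemma sum_latin_free_coord k (F : d.-tuple 'I_M -> R) :
  (forall m j, F (overwrite k m j) = F m) ->
  M%:R * \sum_(m in H) F m = \sum_m F m.
Proof.
move=> Fk; pose swap (x : d.-tuple 'I_M * 'I_M) :=
  (overwrite k x.1 x.2, tnth x.1 k).
have swapK : involutive swap.
  move=> [m j]; congr pair; rewrite /= ?overwriteE ?eqxx//.
  by apply/eq_from_tnth => i; rewrite !overwriteE; case: eqP => [->|].
transitivity (\sum_m \sum_(j | overwrite k m j \in H) F m); last first.
  apply: eq_bigr => m _; have [j [Hj uj]] := latinH k m.
  rewrite (big_pred1 j)// => i; apply/idP/eqP => [/uj->//|->//].
rewrite pair_big_dep/= (reindex_inj (can_inj swapK))/=.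
under [RHS]eq_bigl => x.
  rewrite (_ : overwrite _ _ _ = x.1); last exact: (congr1 fst (swapK x)).
  over.
under [RHS]eq_bigr do rewrite Fk.
rewrite mulr_sumr; transitivity (\sum_(m in H) \sum_(j < M) F m).
  by apply: eq_bigr => m _; rewrite sumr_const card_ord mulr_natl.
by rewrite pair_big /=; apply: eq_bigl => x; rewrite andbT.
Qed.

Let sum_tuple_prod (g : 'I_d -> 'I_M -> R) :
  \sum_(m : d.-tuple 'I_M) \prod_k g k (tnth m k) = \prod_k \sum_j g k j.
Proof.
rewrite bigA_distr_bigA/=
  (reindex (fun m : d.-tuple 'I_M => [ffun k => tnth m k])).
  by apply: eq_bigr => m _; apply: eq_bigr => k _; rewrite ffunE.
exists (fun h : {ffun 'I_d -> 'I_M} => [tuple h k | k < d]) => h _.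
  by apply/eq_from_tnth => k; rewrite tnth_mktuple ffunE.
by apply/ffunP => k; rewrite ffunE tnth_mktuple.
Qed.

Hypotheses (M_gt0 : (0 < M)%N) (d_gt0 : (0 < d)%N).

Let M_neq0 : M%:R != 0 :> R. Proof. by rewrite pnatr_eq0 -lt0n. Qed.

Lemma card_latin : M%:R * #|H|%:R = M%:R ^+ d :> R.
Proof.
rewrite -sumr_const (sum_latin_free_coord (k := Ordinal d_gt0))//.
by rewrite sumr_const card_tuple card_ord natrX.
Qed.

(** Expanding [f k = (f k - a k) + a k] gives one term per set [J] of the
    coordinates where the mean is chosen. If [J] is nonempty, the term does not
    depend on the coordinates in [J], so that its sum over [H] is proportional
    to its sum over the full grid. The latter is a product over the
    coordinates, and any centred factor contributes 0 to it. So only the empty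
    and the full [J] survive. *)
Lemma sum_latin_prod (f : 'I_d -> 'I_M -> R) (a : 'I_d -> R) :
  (forall k, \sum_j f k j = M%:R * a k) ->
  \sum_(m in H) \prod_k f k (tnth m k) =
  \sum_(m in H) \prod_k (f k (tnth m k) - a k) + #|H|%:R * \prod_k a k.
Proof.
move=> fa; pose g (J : {set 'I_d}) k j := if k \in J then a k else f k j - a k.
transitivity (\sum_(J : {set 'I_d}) \sum_(m in H) \prod_k g J k (tnth m k)).
  rewrite exchange_big/=; apply: eq_bigr => m _; rewrite -bigA_distr/=.
  by apply: eq_bigr => k _; rewrite addrC subrK.
rewrite (bigD1 finset.set0)//= (bigD1 [set: 'I_d]%SET)/=; last first.
  by apply/eqP => /setP/(_ (Ordinal d_gt0)); rewrite !inE.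
rewrite [X in _ + (_ + X)]big1 ?addr0 => [|J /andP[J0 JT]].
  congr (_ + _).
    by apply: eq_bigr => m _; apply: eq_bigr => k _; rewrite /g inE.
  rewrite -sumr_const big_distrl/=; apply: eq_bigr => m _.
  by rewrite mul1r; apply: eq_bigr => k _; rewrite /g inE.
have [k0 Jk0] := finset.set0Pn _ J0.
have [k1 JNk1] : exists k, k \notin J.
  move: JT; rewrite -properT properE finset.subsetT/= => /subsetPn[k _ ?].
  by exists k.
apply: (mulfI M_neq0); rewrite mulr0 (sum_latin_free_coord (k := k0)) => [|m j].
  rewrite sum_tuple_prod (bigD1 k1)//= /g (negPf JNk1) sumrB fa sumr_const.
  by rewrite card_ord mulr_natl subrr mul0r.
apply: eq_bigr => k _; rewrite /g tnth_mktuple; case: eqVneq => [->|//].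
by rewrite Jk0.
Qed.

(** With one point fixed, the mean of the kernel over the other one is [c + u]
    of the fixed point. [sum_latin_prod] for the first sum leaves the kernel
    [u + w], and for the second sum it strips [u] as well. *)
Lemma sum2_latin_prod (c : R) (u : 'I_M -> R) (w : 'I_M -> 'I_M -> R) :
  \sum_j u j = 0 ->
  (forall j, \sum_i w i j = 0) -> (forall i, \sum_j w i j = 0) ->
  \sum_(m in H) \sum_(n in H)
      \prod_k (c + u (tnth m k) + u (tnth n k) + w (tnth m k) (tnth n k)) =
  \sum_(m in H) \sum_(n in H) \prod_k w (tnth m k) (tnth n k)
  + 2 * #|H|%:R * \sum_(m in H) \prod_k u (tnth m k) + #|H|%:R ^+ 2 * c ^+ d.
Proof.
move=> u0 w1 w2; have sumc x : \sum_(j < M) x = M%:R * x :> R.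
  by rewrite sumr_const card_ord mulr_natl.
transitivity (\sum_(m in H) (\sum_(n in H) \prod_k
    (u (tnth n k) + w (tnth m k) (tnth n k))
    + #|H|%:R * \prod_k (c + u (tnth m k)))).
  apply: eq_bigr => m _.
  rewrite (sum_latin_prod
    (f := fun k j => c + u (tnth m k) + u j + w (tnth m k) j)
    (a := fun k => c + u (tnth m k))); last first.
    by move=> k; rewrite !big_split/= !sumc u0 w2 mulrDr; ring.
  by congr (_ + _); apply: eq_bigr => n _; apply: eq_bigr => k _; ring.
rewrite big_split/= exchange_big/= -mulr_sumr.
rewrite (sum_latin_prod (f := fun k j => c + u j) (a := fun=> c)); last first.
  by move=> k; rewrite big_split/= u0 sumc addr0.
have -> : \sum_(n in H) \sum_(m in H) \prod_k
      (u (tnth n k) + w (tnth m k) (tnth n k)) =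
    \sum_(n in H) (\sum_(m in H) \prod_k w (tnth m k) (tnth n k)
                   + #|H|%:R * \prod_k u (tnth n k)).
  apply: eq_bigr => n _.
  rewrite (sum_latin_prod (f := fun k i => u (tnth n k) + w i (tnth n k))
    (a := fun k => u (tnth n k))).
    congr (_ + _); apply: eq_bigr => m _; apply: eq_bigr => k _.
    by rewrite addrC addKr.
  by move=> k; rewrite big_split/= sumc w1 addr0.
rewrite big_split/= -mulr_sumr exchange_big/= prodr_const card_ord.
have -> : \sum_(m in H) \prod_k (c + u (tnth m k) - c) =
    \sum_(m in H) \prod_k u (tnth m k).
  by apply: eq_bigr => m _; apply: eq_bigr => k _; rewrite addrC addKr.
ring.
Qed.

End latin_sums.

(** * Integrals and iterated integrals with known values *)

Section has_integral.
Context d (T : measurableType d) (R : realType).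
Variables (mu : {measure set T -> \bar R}) (D : set T).
Hypothesis mD : measurable D.
Implicit Types (f g : T -> R) (F G : T -> T -> R).

(** Integrability is bundled with the value because the integral is additive
    only on integrable functions; together they pass to linear combinations. *)
Definition has_integral f (v : R) : Prop :=
  mu.-integrable D (EFin \o f) /\ (\int[mu]_(x in D) (f x)%:E = v%:E)%E.

Lemma eq_has_integral f g v :
  {in D, f =1 g} -> has_integral f v -> has_integral g v.
Proof.
move=> fg [fi fv]; split.
  by apply: (eq_integrable mD (EFin \o f)) => // x Dx; rewrite /= fg.
by rewrite -fv; apply: eq_integral => x Dx; rewrite fg.
Qed.

Lemma has_integralD f g v w : has_integral f v -> has_integral g w ->
  has_integral (fun x => f x + g x) (v + w).
Proof.
move=> [fi fv] [gi gw]; split.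
  exact: (eq_integrable mD _ _ _ (integrableD mD fi gi)).
under eq_integral do rewrite EFinD.
by rewrite (integralD mD fi gi) /= fv gw.
Qed.

Lemma has_integralZ c f v :
  has_integral f v -> has_integral (fun x => c * f x) (c * v).
Proof.
move=> [fi fv]; split.
  exact: (eq_integrable mD _ _ _ (integrableZl mD c fi)).
under eq_integral do rewrite EFinM.
by rewrite (integralZl mD fi) /= fv.
Qed.

Lemma has_integral0 : has_integral (fun=> 0) 0.
Proof. by split; [exact: integrable0|rewrite integral0]. Qed.

(** Integrability is asked of each stage separately: the discrepancies are
    iterated integrals, so no function on the product space is needed. *)
Definition has_iterated_integral F v : Prop :=
  exists2 f, {in D, forall x, has_integral (F x) (f x)} & has_integral f v.

Lemma eq_has_iterated_integral F G v :
  {in D &, forall x y, F x y = G x y} ->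
  has_iterated_integral F v -> has_iterated_integral G v.
Proof.
move=> FG [f Ff fv]; exists f => // x Dx.
by apply: (eq_has_integral _ (Ff x Dx)) => y Dy; rewrite FG.
Qed.

Lemma has_iterated_integralD F G v w :
  has_iterated_integral F v -> has_iterated_integral G w ->
  has_iterated_integral (fun x y => F x y + G x y) (v + w).
Proof.
move=> [f Ff fv] [g Gg gw]; exists (fun x => f x + g x).
  by move=> x Dx; exact: has_integralD (Ff x Dx) (Gg x Dx).
exact: has_integralD.
Qed.

Lemma has_iterated_integralZ c F v : has_iterated_integral F v ->
  has_iterated_integral (fun x y => c * F x y) (c * v).
Proof.
move=> [f Ff fv]; exists (fun x => c * f x); last exact: has_integralZ.
by move=> x Dx; exact: has_integralZ (Ff x Dx).
Qed.

Lemma has_iterated_integral_sum (I : Type) (r : seq I) (P : pred I)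
    (F : I -> T -> T -> R) (v : I -> R) :
  (forall i, P i -> has_iterated_integral (F i) (v i)) ->
  has_iterated_integral (fun x y => \sum_(i <- r | P i) F i x y)
    (\sum_(i <- r | P i) v i).
Proof.
move=> Fv; elim: r => [|i r IHr].
  rewrite big_nil; exists (fun=> 0); last exact: has_integral0.
  move=> x _; apply: (eq_has_integral _ has_integral0) => y _.
  by rewrite big_nil.
have [Pi|PNi] := boolP (P i).
  rewrite big_cons Pi; apply: (eq_has_iterated_integral _
    (has_iterated_integralD (Fv i Pi) IHr)) => x y _ _.
  by rewrite big_cons Pi.
rewrite big_cons (negPf PNi).
apply: (eq_has_iterated_integral _ IHr) => x y _ _.
by rewrite big_cons (negPf PNi).
Qed.

Lemma has_iterated_integral_ge0 F v : {in D &, forall x y, 0 <= F x y} ->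
  has_iterated_integral F v -> 0 <= v.
Proof.
move=> F0 [f Ff [_ fv]]; rewrite -lee_fin -fv; apply: integral_ge0 => x Dx.
have [_ <-] := Ff x (mem_set Dx); apply: integral_ge0 => y Dy.
by rewrite lee_fin F0// mem_set.
Qed.

Lemma has_iterated_integralE F v : has_iterated_integral F v ->
  (\int[mu]_(x in D) \int[mu]_(y in D) (F x y)%:E = v%:E)%E.
Proof.
by move=> [f Ff [_ <-]]; apply: eq_integral => x Dx; have [_ ->] := Ff x Dx.
Qed.

End has_integral.

(** * Integrals of products over the unit cube *)

Section product.
Variable R : realType.

Let leb : {measure set (measurableTypeR R) -> \bar R} := @lebesgue_measure R.

(** Tonelli's theorem, by induction on the dimension. Nonnegative factors are
    all that the discrepancies need, and for them no integrability has to be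
    known in advance. *)
Lemma integral_lebesgue_tuple_prod d (f : 'I_d -> measurableTypeR R -> R) :
  (forall k, measurable_fun setT (f k)) -> (forall k x, 0 <= f k x) ->
  (\int[lebesgue_tuple R d]_x (\prod_(k < d) f k (tnth x k))%:E
   = \prod_(k < d) \int[leb]_x (f k x)%:E)%E.
Proof.
elim: d f => [|d IHd] f mf f0.
  rewrite big_ord0 /= integral_dirac//=.
    by rewrite diracT mul1e big_ord0.
  apply/measurable_EFinP.
  by under eq_fun do rewrite big_ord0; exact: measurable_cst.
have mprod n (g : 'I_n -> measurableTypeR R -> R) :
    (forall k, measurable_fun setT (g k)) ->
    measurable_fun setT
      (fun x : n.-tuple (measurableTypeR R) => \prod_k g k (tnth x k)).
  move=> mg; apply: measurable_prod => k _.
  by apply: measurableT_comp => //; exact: measurable_tnth.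
rewrite /= /lebesgue_step ge0_integral_pushforward//=; last first.
- by move=> x _; rewrite lee_fin prodr_ge0.
- by apply/measurable_EFinP; exact: mprod.
- exact: measurable_tcons.
rewrite preimage_setT fubini_tonelli1/=; last first.
- by move=> x; rewrite lee_fin prodr_ge0.
- apply/measurable_EFinP; apply: (measurableT_comp (mprod _ _ mf)).
  exact: measurable_tcons.
rewrite big_ord_recl -(IHd (fun k => f (lift ord0 k)))//.
rewrite -ge0_integralZr//=; last 3 first.
- exact/measurable_EFinP.
- by move=> x _; rewrite lee_fin.
- by apply: integral_ge0 => x _; rewrite lee_fin prodr_ge0.
apply: eq_integral => x _.
rewrite /fubini_F /= -ge0_integralZl//=; last 3 first.
- by apply/measurable_EFinP; exact: (mprod _ (fun k => f (lift ord0 k))) => k.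
- by move=> y _; rewrite lee_fin prodr_ge0.
- by rewrite lee_fin.
apply: eq_integral => y _; rewrite big_ord_recl/= -EFinM; congr (_ * _)%:E.
by apply: eq_bigr => k _; rewrite tnthS.
Qed.

Definition itv01 : set (measurableTypeR R) := [set` `[0, 1[].

Lemma measurable_itv01 : measurable itv01.
Proof. exact: measurable_itv. Qed.

Lemma measurable_unit_cube d : measurable (unit_cube R d).
Proof.
rewrite (_ : unit_cube R d =
    \bigcap_(k in [set: 'I_d]) ((@tnth _ _)^~ k @^-1` itv01)).
  apply: fin_bigcap_measurable => // k _.
  rewrite -[X in measurable X]setTI.
  by apply: measurable_tnth => //; exact: measurable_itv01.
apply/seteqP; split => x /= Ax k; [move=> _|]; move: (Ax k);
  by rewrite /itv01/= in_itv; apply.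
Qed.

(** Extending the factors by 0 outside [0, 1[ turns the integral over the cube
    into one over the whole space. Integrability comes from the value being
    finite, as the product is nonnegative. *)
Lemma has_integral_prod d (f : 'I_d -> measurableTypeR R -> R) (v : 'I_d -> R) :
  (forall k, {in itv01, forall x, 0 <= f k x}) ->
  (forall k, has_integral leb itv01 (f k) (v k)) ->
  has_integral (lebesgue_tuple R d) (unit_cube R d)
    (fun x => \prod_k f k (tnth x k)) (\prod_k v k).
Proof.
move=> f0 fv; pose g k := f k \_ itv01.
have g0 k x : 0 <= g k x by rewrite /g patchE; case: ifPn => // /f0.
have mg k : measurable_fun setT (g k).
  apply/(measurable_restrictT _ measurable_itv01).
  by have [/measurable_int/measurable_EFinP] := fv k.
have gE (x : d.-tuple (measurableTypeR R)) : \prod_k g k (tnth x k) =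
    ((fun x => \prod_k f k (tnth x k)) \_ (unit_cube R d)) x.
  rewrite patchE; case: ifPn => [/set_mem x01|xN01].
    apply: eq_bigr => k _; rewrite /g patchE mem_set//= /itv01/= in_itv.
    exact: x01.
  have [k xkN] : exists k, ~ 0 <= (tnth x k : R) < 1.
    by apply/existsNP => x01; move/negP: xN01; apply; apply/mem_set.
  by rewrite (bigD1 k)//= {1}/g patchE memNset ?mul0r.
have int_g : (\int[lebesgue_tuple R d]_x (\prod_k g k (tnth x k))%:E =
    (\prod_k v k)%:E)%E.
  rewrite integral_lebesgue_tuple_prod// -prodEFin; apply: eq_bigr => k _.
  by have [_ <-] := fv k; rewrite [RHS]integral_mkcond restrict_EFin.
split.
  apply/integrable_mkcond; first exact: measurable_unit_cube.
  rewrite restrict_EFin.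
  rewrite [X in integrable _ _ X](_ : _ =
      (fun x => (\prod_k g k (tnth x k))%:E)); last first.
    by apply/funext => x; rewrite gE.
  apply/integrableP; split.
    apply/measurable_EFinP; apply: measurable_prod => k _.
    by apply: measurableT_comp => //; exact: measurable_tnth.
  under eq_integral do rewrite gee0_abs ?lee_fin ?prodr_ge0//.
  by rewrite int_g ltry.
rewrite integral_mkcond restrict_EFin -int_g.
by apply: eq_integral => x _ /=; rewrite gE.
Qed.

Lemma has_iterated_integral_prod d
    (F : 'I_d -> measurableTypeR R -> measurableTypeR R -> R) (v : 'I_d -> R) :
  (forall k, {in itv01 &, forall x y, 0 <= F k x y}) ->
  (forall k, has_iterated_integral leb itv01 (F k) (v k)) ->
  has_iterated_integral (lebesgue_tuple R d) (unit_cube R d)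
    (fun x y => \prod_k F k (tnth x k) (tnth y k)) (\prod_k v k).
Proof.
move=> F0 Fv.
have /choice[f fF] : forall k, exists f,
    {in itv01, forall x, has_integral leb itv01 (F k x) (f x)}
    /\ has_integral leb itv01 f (v k).
  by move=> k; have [f ? ?] := Fv k; exists f.
have tnth01 (x : d.-tuple (measurableTypeR R)) k : x \in unit_cube R d ->
    tnth x k \in itv01.
  by move=> /set_mem/(_ k) x01; apply/mem_set; rewrite /itv01/= in_itv.
exists (fun x => \prod_k f k (tnth x k)) => [x x01|].
  apply: (has_integral_prod (f := fun k => F k (tnth x k))) => k.
    by move=> y y01; apply: F0 => //; exact: tnth01.
  by apply: (fF k).1; exact: tnth01.
apply: has_integral_prod => k; last exact: (fF k).2.
move=> x x01; rewrite -lee_fin -((fF k).1 x x01).2.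
apply: integral_ge0 => y y01.
by rewrite lee_fin F0// mem_set.
Qed.

End product.

(** * Integrals of piecewise cubic functions *)

Section piecewise_cubic.
Variable R : realType.
Let leb : {measure set (measurableTypeR R) -> \bar R} := @lebesgue_measure R.
Local Notation I01 := (@itv01 R).

(** All four kinds of bounded interval are covered, because the pieces of the
    kernels below have closed and open ends in various combinations. *)
Lemma integral_deriv_poly (P : {poly R}) (a b : R) (l r : bool) : a <= b ->
  (\int[leb]_(x in [set` Interval (BSide l a) (BSide r b)]) (P^`().[x])%:E
   = (P.[b] - P.[a])%:E)%E.
Proof.
have mP (i : interval R) : measurable_fun ([set` i] : set (measurableTypeR R))
    (fun x => (P^`().[x])%:E).
  by apply/measurable_EFinP; exact: measurable_poly.
move=> ab; rewrite (@integral_itv_bndoo _ a b _ l r); last exact: mP.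
rewrite -(@integral_itv_bndoo _ a b _ true false); last exact: mP.
move: ab; rewrite le_eqVlt => /predU1P[<-|ab].
  by rewrite subrr set_itv1 integral_set1.
rewrite (continuous_FTC2 (F := horner P) ab) ?EFinB//.
- by apply: continuous_subspaceT => x; exact: continuous_horner.
- split.
  + by move=> x _; exact: derivable_horner.
  + by apply: cvg_at_right_filter; exact: continuous_horner.
  + by apply: cvg_at_left_filter; exact: continuous_horner.
- by move=> x _; rewrite derivE.
Qed.

Lemma has_integral_deriv_poly (P : {poly R}) (a b : R) (l r : bool) :
  let i := Interval (BSide l a) (BSide r b) in
  a <= b -> [set` i] `<=` I01 ->
  has_integral leb I01 (fun x => if x \in i then P^`().[x] else 0)
    (P.[b] - P.[a]).
Proof.
move=> i ab i01.
have fE : (fun x => (if x \in i then P^`().[x] else 0)%:E) \_ I01 =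
    (fun x => (P^`().[x])%:E) \_ [set` i].
  apply/funext => x; rewrite !patchE; case: (boolP (x \in I01)) => [_|xN01].
    by rewrite (_ : (x \in [set` i]) = (x \in i)) ?mem_setE//; case: (x \in i).
  by case: ifPn => // /set_mem /i01 /mem_set; rewrite (negPf xN01).
have intP : leb.-integrable ([set` i] : set (measurableTypeR R))
    (fun x => (P^`().[x])%:E).
  apply: (@integrableS _ _ _ leb `[a, b]); [exact: measurable_itv..| |].
    by apply: subset_itv; rewrite bnd_simp.
  apply: continuous_compact_integrable; first exact: segment_compact.
  by apply: continuous_subspaceT => x; exact: continuous_horner.
split.
  apply/integrable_mkcond; first exact: measurable_itv01.
  rewrite [X in integrable _ _ X]fE.
  by have /integrable_mkcond := intP; apply; exact: measurable_itv.
by rewrite integral_mkcond fE -integral_mkcond integral_deriv_poly.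
Qed.

(** Degree 3 is enough: the squared length of an arc is quadratic in each
    endpoint, and its first integral is cubic. *)
Lemma has_integral_cubic_piece (c0 c1 c2 c3 a b : R) (l r : bool) :
  let i := Interval (BSide l a) (BSide r b) in
  a <= b -> [set` i] `<=` I01 ->
  has_integral leb I01
    (fun x => if x \in i then c0 + c1 * x + c2 * x ^+ 2 + c3 * x ^+ 3 else 0)
    (c0 * (b - a) + c1 * (b ^+ 2 - a ^+ 2) / 2 + c2 * (b ^+ 3 - a ^+ 3) / 3
       + c3 * (b ^+ 4 - a ^+ 4) / 4).
Proof.
move=> i ab i01.
pose P : {poly R} :=
  c0 *: 'X + (c1 / 2) *: 'X^2 + (c2 / 3) *: 'X^3 + (c3 / 4) *: 'X^4.
have -> : c0 * (b - a) + c1 * (b ^+ 2 - a ^+ 2) / 2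
    + c2 * (b ^+ 3 - a ^+ 3) / 3 + c3 * (b ^+ 4 - a ^+ 4) / 4 = P.[b] - P.[a].
  by rewrite /P !(hornerD, hornerZ, hornerX, hornerXn); field.
apply: eq_has_integral (has_integral_deriv_poly P ab i01).
  exact: measurable_itv01.
move=> x _; rewrite -/i; case: ifP => // _.
rewrite /P !(derivD, derivZ, derivX, derivXn).
by rewrite !(hornerD, hornerZ, hornerMn, hornerXn) hornerC; field.
Qed.

End piecewise_cubic.

Arguments itv01 R : clear implicits.

(** * The one-dimensional kernels *)

Section kernels.
Variable R : realType.
Let leb : {measure set (measurableTypeR R) -> \bar R} := @lebesgue_measure R.
Local Notation I01 := (@itv01 R).

Lemma has_integral_ext (f g : R -> R) v w :
  (forall x, 0 <= x < 1 -> f x = g x) -> v = w ->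
  has_integral leb I01 f v -> has_integral leb I01 g w.
Proof.
move=> fg <-; apply: eq_has_integral; first exact: measurable_itv01.
by move=> x /set_mem; rewrite /itv01/= in_itv => /fg.
Qed.

Lemma sub_itv01 (i : interval R) :
  (forall x, x \in i -> 0 <= x < 1) -> [set` i] `<=` I01.
Proof. by move=> H x /= /H; rewrite /itv01/= in_itv. Qed.

Definition arc_mem (x y p : R) : bool :=
  if x < y then x <= p < y else (x <= p) || (p < y).

Definition arc_len (x y : R) : R := if x < y then y - x else 1 - x + y.

(** The product of the lengths of the two arcs into which [p] and [q] cut the
    circle of length 1. *)
Definition gap (p q : R) : R := `|p - q| * (1 - `|p - q|).

Definition parabola (p : R) : R := p * (1 - p).

Let gapC p q : gap p q = gap q p.
Proof. by rewrite /gap distrC. Qed.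

Let gap_le p q : p <= q -> gap p q = (q - p) * (1 - (q - p)).
Proof. by move=> pq; rewrite /gap ler0_norm ?subr_le0// opprB. Qed.

(* Settles a comparison of the goal from at most two hypotheses. *)
Ltac decide_comparison := match goal with
  | H : is_true (?u <= ?v) |- context[?u <= ?v] => rewrite H
  | H : is_true (?u < ?v) |- context[?u < ?v] => rewrite H
  | H : is_true (?u < ?v) |- context[?u <= ?v] => rewrite (ltW H)
  | H : is_true (?u < ?v) |- context[?v <= ?u] => rewrite (lt_geF H)
  | H : is_true (?u < ?v) |- context[?v < ?u] => rewrite (lt_gtF H)
  | H : is_true (?u <= ?v) |- context[?v < ?u] => rewrite (le_gtF H)
  | H : is_true (?u <= ?w), K : is_true (?w <= ?v) |- context[?u <= ?v] =>
      rewrite (le_trans H K)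
  | H : is_true (?u < ?w), K : is_true (?w <= ?v) |- context[?u <= ?v] =>
      rewrite (ltW (lt_le_trans H K))
  | H : is_true (?u <= ?w), K : is_true (?w < ?v) |- context[?u <= ?v] =>
      rewrite (ltW (le_lt_trans H K))
  | H : is_true (?u < ?w), K : is_true (?w < ?v) |- context[?u <= ?v] =>
      rewrite (ltW (lt_trans H K))
  | H : is_true (?u < ?w), K : is_true (?w <= ?v) |- context[?u < ?v] =>
      rewrite (lt_le_trans H K)
  | H : is_true (?u <= ?w), K : is_true (?w < ?v) |- context[?u < ?v] =>
      rewrite (le_lt_trans H K)
  | H : is_true (?u < ?w), K : is_true (?w < ?v) |- context[?u < ?v] =>
      rewrite (lt_trans H K)
  | H : is_true (?u < ?w), K : is_true (?w <= ?v) |- context[?v <= ?u] =>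
      rewrite (lt_geF (lt_le_trans H K))
  | H : is_true (?u <= ?w), K : is_true (?w < ?v) |- context[?v <= ?u] =>
      rewrite (lt_geF (le_lt_trans H K))
  | H : is_true (?u <= ?w), K : is_true (?w <= ?v) |- context[?v < ?u] =>
      rewrite (le_gtF (le_trans H K))
  end.

(* Proves an identity between piecewise polynomial functions by splitting on
   the comparisons it contains. Deciding what follows from earlier splits
   keeps the number of cases, each of which calls a linear solver, small. *)
Ltac piecewise := move=> ? /andP[? ?]; rewrite ?in_itv /= /arc_mem /arc_len;
  repeat first [ progress decide_comparison; rewrite /=
  | match goal with |- context[?u < ?v] => case: (ltP u v) => ? /=
                | |- context[?u <= ?v] => case: (leP u v) => ? /= end];
  by lra.

Ltac in_unit := apply: sub_itv01 => ?; rewrite in_itv /= => /andP[? ?];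
  apply/andP; split; lra.

Let in01 (x : R) : x \in I01 -> 0 <= x /\ x < 1.
Proof. by move=> /set_mem; rewrite /itv01/= in_itv/= => /andP. Qed.

Let has_integral_piece := @has_integral_cubic_piece R.

(** The factor 2 makes the weight of the triangle [x < y] have total mass 1, as
    the weight 1 has on the square in the periodic case. *)
Lemma extr_length_sq :
  has_iterated_integral leb I01
    (fun x y => 2 * (x < y)%R%:R * arc_len x y ^+ 2) 6^-1.
Proof.
exists (fun x => 2 * (1 - x) ^+ 3 / 3) => [x /in01[x0 x1]|].
  have i : [set` `]x, 1[] `<=` I01 by in_unit.
  apply: has_integral_ext
    (has_integral_piece (2 * x ^+ 2) (- 4 * x) 2 0 (ltW x1) i); last by field.
  by piecewise.
have i : [set` `[0 : R, 1[] `<=` I01 by [].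
apply: has_integral_ext
  (has_integral_piece (2 / 3) (- 2) 2 (- (2 / 3)) ler01 i); last by field.
by piecewise.
Qed.

Lemma extr_single p : 0 <= p -> p < 1 ->
  has_iterated_integral leb I01
    (fun x y => 2 * (x < y)%R%:R * ((arc_mem x y p)%:R * arc_len x y))
    (parabola p).
Proof.
move=> p0 p1.
have ip : [set` `]p, 1[] `<=` I01 by in_unit.
have ip' : [set` `[0, p]] `<=` I01 by in_unit.
exists (fun x => if x <= p then (1 - p ^+ 2) - 2 * x * (1 - p) else 0).
  move=> x /in01[x0 x1]; case: (leP x p) => xp.
    apply: has_integral_ext
      (has_integral_piece (- 2 * x) 2 0 0 (ltW p1) ip); last by field.
    by piecewise.
  by apply: has_integral_ext (has_integral0 leb I01) => //; piecewise.
apply: has_integral_ext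
  (has_integral_piece (1 - p ^+ 2) (- 2 * (1 - p)) 0 0 p0 ip');
  last by rewrite /parabola; field.
by piecewise.
Qed.

(** Up to the factor 2 this is [min(p, q) (1 - max(p, q))]: the interval must
    start before both points and end after both. *)
Lemma extr_pair p q : 0 <= p -> p < 1 -> 0 <= q -> q < 1 ->
  has_iterated_integral leb I01
    (fun x y => 2 * (x < y)%R%:R * ((arc_mem x y p)%:R * (arc_mem x y q)%:R))
    (parabola p + parabola q - gap p q).
Proof.
wlog pq : p q / p <= q => [hw|p0 p1 q0 q1].
  case: (leP p q) => [|/ltW qp p0 p1 q0 q1]; first exact: hw.
  have := hw _ _ qp q0 q1 p0 p1; rewrite gapC [parabola p + _]addrC.
  apply: eq_has_iterated_integral; first exact: measurable_itv01.
  by move=> x y _ _; rewrite [in LHS](mulrC (arc_mem _ _ _)%:R).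
have iq : [set` `]q, 1[] `<=` I01 by in_unit.
have ip : [set` `[0, p]] `<=` I01 by in_unit.
rewrite gap_le//; exists (fun x => if x <= p then 2 * (1 - q) else 0).
  move=> x /in01[x0 x1]; case: (leP x p) => xp.
    apply: has_integral_ext
      (has_integral_piece 2 0 0 0 (ltW q1) iq); last by field.
    by piecewise.
  by apply: has_integral_ext (has_integral0 leb I01) => //; piecewise.
apply: has_integral_ext
  (has_integral_piece (2 * (1 - q)) 0 0 0 p0 ip);
  last by rewrite /parabola; field.
by piecewise.
Qed.

(** The inner integral is constant: for fixed [x] the arc length is uniformly
    distributed on [0, 1]. *)
Lemma per_length_sq :
  has_iterated_integral leb I01 (fun x y => arc_len x y ^+ 2) 3^-1.
Proof.
exists (fun x => 3^-1) => [x /in01[x0 x1]|].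
  have i : [set` `]x, 1[] `<=` I01 by in_unit.
  have i' : [set` `[0, x]] `<=` I01 by in_unit.
  apply: has_integral_ext (has_integralD (@measurable_itv01 R)
    (has_integral_piece ((1 - x) ^+ 2) (2 * (1 - x)) 1 0 x0 i')
    (has_integral_piece (x ^+ 2) (- 2 * x) 1 0 (ltW x1) i)); last by field.
  by piecewise.
have i : [set` `[0 : R, 1[] `<=` I01 by [].
apply: has_integral_ext
  (has_integral_piece (3^-1) 0 0 0 ler01 i); last by field.
by piecewise.
Qed.

(** The value is that of [per_length_sq]: by rotation invariance it does not
    depend on [p], and averaging over [p] turns the indicator into the
    length. *)
Lemma per_single p : 0 <= p -> p < 1 ->
  has_iterated_integral leb I01
    (fun x y => (arc_mem x y p)%:R * arc_len x y) 3^-1.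
Proof.
move=> p0 p1.
have ip : [set` `]p, 1[] `<=` I01 by in_unit.
have ip' : [set` `[0, p]] `<=` I01 by in_unit.
exists (fun x => if x <= p then (1 - p ^+ 2) / 2 + p * x - x ^+ 2 / 2
                 else - p - p ^+ 2 / 2 + (1 + p) * x - x ^+ 2 / 2).
  move=> x /in01[x0 x1]; case: (leP x p) => xp.
    have i : [set` `[0, x]] `<=` I01 by in_unit.
    apply: has_integral_ext (has_integralD (@measurable_itv01 R)
      (has_integral_piece (1 - x) 1 0 0 x0 i)
      (has_integral_piece (- x) 1 0 0 (ltW p1) ip)); last by field.
    by piecewise.
  have i : [set` `]p, x]] `<=` I01 by in_unit.
  apply: has_integral_ext
    (has_integral_piece (1 - x) 1 0 0 (ltW xp) i); last by field.
  by piecewise.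
apply: has_integral_ext (has_integralD (@measurable_itv01 R)
  (has_integral_piece ((1 - p ^+ 2) / 2) p (- 2^-1) 0 p0 ip')
  (has_integral_piece (- p - p ^+ 2 / 2) (1 + p) (- 2^-1) 0 (ltW p1) ip));
  last by field.
by piecewise.
Qed.

(** Both endpoints must fall in the same one of the two arcs cut out by [p] and
    [q], and in the right order. If these have lengths [t] and [1 - t], this
    has probability [(t^2 + (1 - t)^2) / 2 = 1/2 - t (1 - t)]. *)
Lemma per_pair p q : 0 <= p -> p < 1 -> 0 <= q -> q < 1 ->
  has_iterated_integral leb I01
    (fun x y => (arc_mem x y p)%:R * (arc_mem x y q)%:R) (2^-1 - gap p q).
Proof.
wlog pq : p q / p <= q => [hw|p0 p1 q0 q1].
  case: (leP p q) => [|/ltW qp p0 p1 q0 q1]; first exact: hw.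
  have := hw _ _ qp q0 q1 p0 p1; rewrite gapC.
  apply: eq_has_iterated_integral; first exact: measurable_itv01.
  by move=> x y _ _; rewrite [in LHS](mulrC (arc_mem _ _ _)%:R).
have iq : [set` `]q, 1[] `<=` I01 by in_unit.
have ip : [set` `[0, p]] `<=` I01 by in_unit.
have ipq : [set` `]p, q]] `<=` I01 by in_unit.
(* The admissible y are those in ]q, 1[ and [0, x], in ]p, x], or in ]q, x],
   according to the position of x. *)
rewrite gap_le//; exists (fun x => if x <= p then 1 - q + x
                                   else if x <= q then x - p else x - q).
  move=> x /in01[x0 x1]; case: (leP x p) => xp.
    have i : [set` `[0, x]] `<=` I01 by in_unit.
    apply: has_integral_ext (has_integralD (@measurable_itv01 R)
      (has_integral_piece 1 0 0 0 x0 i)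
      (has_integral_piece 1 0 0 0 (ltW q1) iq)); last by field.
    by piecewise.
  case: (leP x q) => xq.
    have i : [set` `]p, x]] `<=` I01 by in_unit.
    apply: has_integral_ext
      (has_integral_piece 1 0 0 0 (ltW xp) i); last by field.
    by piecewise.
  have i : [set` `]q, x]] `<=` I01 by in_unit.
  apply: has_integral_ext
    (has_integral_piece 1 0 0 0 (ltW xq) i); last by field.
  by piecewise.
apply: has_integral_ext (has_integralD (@measurable_itv01 R)
  (has_integralD (@measurable_itv01 R)
    (has_integral_piece (1 - q) 1 0 0 p0 ip)
    (has_integral_piece (- p) 1 0 0 pq ipq))
  (has_integral_piece (- q) 1 0 0 (ltW q1) iq)); last by field.
by piecewise.
Qed.

End kernels.

(** * Means over the lattice of multiples of 1/M *)

Section lattice_means.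
Variables (R : realType) (M : nat).

Definition lattice_pt (j : 'I_M) : R := j%:R / M%:R.

(** The mean of [parabola], and of each [gap p], over the lattice. *)
Definition mean_gap : R := (M%:R ^+ 2 - 1) / (6 * M%:R ^+ 2).

Lemma lattice_pt_itv j : 0 <= lattice_pt j < 1.
Proof.
have M0 : 0 < M%:R :> R by rewrite ltr0n (leq_ltn_trans _ (ltn_ord j)).
by rewrite divr_ge0 ?ler0n//= ltr_pdivrMr// mul1r ltr_nat.
Qed.

Lemma lattice_pt_inj : injective lattice_pt.
Proof.
move=> i j; have M0 : M%:R != 0 :> R.
  by rewrite pnatr_eq0 -lt0n (leq_ltn_trans _ (ltn_ord i)).
by move/(divIf M0)/eqP; rewrite eqr_nat => /eqP/val_inj.
Qed.

Lemma sum_parabola : (0 < M)%N ->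
  \sum_(j < M) parabola (lattice_pt j) = M%:R * mean_gap.
Proof.
move=> M_gt0; have M0 : M%:R != 0 :> R by rewrite pnatr_eq0 -lt0n.
(* In the induction the upper bound has to vary independently of M. *)
pose S (n : R) : R := M%:R * n * (n - 1) / 2 - n * (n - 1) * (2 * n - 1) / 6.
have sumS n : \sum_(j < n) j%:R * (M%:R - j%:R) = S n%:R.
  elim: n => [|n IHn]; first by rewrite big_ord0 /S; ring.
  by rewrite big_ord_recr/= IHn /S -natr1; field.
transitivity ((\sum_(j < M) j%:R * (M%:R - j%:R)) / M%:R ^+ 2 : R).
  rewrite mulr_suml; apply: eq_bigr => j _.
  by rewrite /parabola /lattice_pt; field.
by rewrite sumS /S /mean_gap; field.
Qed.

End lattice_means.

(** [gap] only depends on the difference modulo 1, so translating the lattice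
    turns its mean into that of [parabola]. *)
Lemma sum_gap (R : realType) (M : nat) (i : 'I_M) :
  \sum_(j < M) gap (lattice_pt R i) (lattice_pt R j) = M%:R * mean_gap R M.
Proof.
case: M i => [[]//|M] i; rewrite -sum_parabola//.
(* The translation j |-> i - j of the cyclic group of ordinals. *)
rewrite [RHS](reindex_inj (inj_comp (addrI i) oppr_inj))/=.
apply: eq_bigr => j _.
have M0 : M.+1%:R != 0 :> R by rewrite pnatr_eq0.
rewrite /gap /parabola /lattice_pt -mulrBl normrM.
rewrite (@ger0_norm _ M.+1%:R^-1) ?invr_ge0 ?ler0n//=.
have [ji|ij] := leqP j i.
  have -> : ((i + (M.+1 - j) %% M.+1) %% M.+1)%N = (i - j)%N.
    rewrite modnDmr addnBA 1?ltnW// addnC -addnBA//.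
    by rewrite modnDl modn_small// (leq_ltn_trans (leq_subr _ _)).
  by rewrite -natrB// normr_nat.
have -> : ((i + (M.+1 - j) %% M.+1) %% M.+1)%N = (M.+1 - (j - i))%N.
  rewrite modnDmr addnC addnBAC 1?ltnW// -subnBA 1?ltnW// modn_small//.
  by rewrite ltn_subrL subn_gt0 ij.
rewrite distrC -natrB 1?ltnW// normr_nat [in RHS]natrB; first by field.
by rewrite (leq_trans (leq_subr _ _))// ltnW.
Qed.

(** * The discrepancy of a Latin hypercube as a sum over pairs of points *)

Section card.
Variables (R : realType) (M d : nat).
Implicit Types H : {set d.-tuple 'I_M}.

Definition latin_point (m : d.-tuple 'I_M) : 'RR[R]_d :=
  [tuple lattice_pt R (tnth m i) | i < d].

Lemma tnth_latin_point m k : tnth (latin_point m) k = lattice_pt R (tnth m k).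
Proof. by rewrite tnth_mktuple. Qed.

Lemma latin_point_inj : injective latin_point.
Proof.
move=> m n mn; apply/eq_from_tnth => k; apply: (@lattice_pt_inj R).
by rewrite -!tnth_latin_point mn.
Qed.

Lemma card_latin_points H : card_of (latin_points R H) = #|H|.
Proof.
rewrite /card_of (_ : fset_set _ = [fset latin_point m | m in H]%fset).
  by rewrite card_imfset ?cardE//; exact: latin_point_inj.
apply/fsetP => x; rewrite in_fset_set; last exact: finite_image.
apply/idP/imfsetP => [/set_mem[m Hm <-]|[m Hm ->]]; first by exists m.
by apply/mem_set; exists m.
Qed.

End card.

Section latin_discrepancy.
Variables (R : realType) (M d : nat) (H : {set d.-tuple 'I_M}).
Let leb : {measure set (measurableTypeR R) -> \bar R} := @lebesgue_measure R.
Let mu := lebesgue_tuple R d.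
Implicit Types (m n : d.-tuple 'I_M).

Lemma periodic_itvE (x y p : R) :
  0 <= p < 1 -> periodic_itv x y p <-> arc_mem x y p.
Proof.
move=> p01; rewrite /periodic_itv /arc_mem; case: ltP => _ /=.
  by split=> [[]|].
by split=> [[_ /orP]|/orP].
Qed.

Let arc_count m (x y : 'RR[R]_d) : R :=
  \prod_k (arc_mem (tnth x k) (tnth y k) (lattice_pt R (tnth m k)))%:R.

Lemma discrepancy_latin_points (x y : 'RR[R]_d) :
  unit_cube R d x -> unit_cube R d y ->
  discrepancy (latin_points R H) x y =
  \sum_(m in H) arc_count m x y
  - #|H|%:R * \prod_k arc_len (tnth x k : R) (tnth y k).
Proof.
move=> x01 y01; rewrite /discrepancy volume_periodic_box// card_latin_points.
congr (_ - _).
pose inbox m :=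
  [forall k, arc_mem (tnth x k) (tnth y k) (lattice_pt R (tnth m k))].
have -> : latin_points R H `&` periodic_box x y =
    latin_points R [set m in H | inbox m]%SET.
  apply/seteqP; split => z /=.
    move=> [[m Hm <-] zxy]; exists m => //=; rewrite inE Hm; apply/forallP => k.
    apply/periodic_itvE; first exact: lattice_pt_itv.
    by have := zxy k; rewrite tnth_mktuple.
  move=> [m]; rewrite /= inE => /andP[Hm /forallP mxy] <-.
  split; first by exists m.
  move=> k; rewrite tnth_mktuple.
  by apply/periodic_itvE => //; exact: lattice_pt_itv.
rewrite card_latin_points -sum1_card natr_sum.
under eq_bigl do rewrite inE.
rewrite big_mkcondr/=; apply: eq_bigr => m _; rewrite /arc_count /inbox.
case: ifPn => [/forallP mxy|/forallPn[k /negPf kN]].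
  by rewrite big1// => k _; rewrite mxy.
by rewrite (bigD1 k)//= kN mul0r.
Qed.

(** The weight [w] is 1 for the periodic discrepancy and twice the indicator of
    [x < y] for the extreme one. After expanding the square, every term is a
    product over the coordinates, and only the three one-dimensional integrals
    [K], [s] and [l] are needed. *)
Lemma has_iterated_integral_discrepancy
    (w K : R -> R -> R) (s : R -> R) (l : R) :
  {in itv01 R &, forall x y, 0 <= w x y} ->
  (forall p q, 0 <= p < 1 -> 0 <= q < 1 ->
    has_iterated_integral leb (itv01 R)
      (fun x y => w x y * ((arc_mem x y p)%:R * (arc_mem x y q)%:R)) (K p q)) ->
  (forall p, 0 <= p < 1 ->
    has_iterated_integral leb (itv01 R)
      (fun x y => w x y * ((arc_mem x y p)%:R * arc_len x y)) (s p)) ->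
  has_iterated_integral leb (itv01 R) (fun x y => w x y * arc_len x y ^+ 2) l ->
  has_iterated_integral mu (unit_cube R d)
    (fun x y => (\prod_k w (tnth x k) (tnth y k))
                * discrepancy (latin_points R H) x y ^+ 2)
    (\sum_(m in H) \sum_(n in H)
        \prod_k K (lattice_pt R (tnth m k)) (lattice_pt R (tnth n k))
     + (- (2 * #|H|%:R) * \sum_(m in H) \prod_k s (lattice_pt R (tnth m k))
        + #|H|%:R ^+ 2 * l ^+ d)).
Proof.
move=> w0 Kw sw lw; have mcube := @measurable_unit_cube R d.
have len0 : {in itv01 R &, forall x y, 0 <= arc_len x y}.
  move=> x y /set_mem + /set_mem; rewrite /itv01/= !in_itv/= => x01 y01.
  by rewrite /arc_len; case: ltP => xy; lra.
have prod_int (F : 'I_d -> R -> R -> R) (v : 'I_d -> R) :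
    (forall k, {in itv01 R &, forall x y, 0 <= F k x y}) ->
    (forall k, has_iterated_integral leb (itv01 R)
       (fun x y => w x y * F k x y) (v k)) ->
    has_iterated_integral mu (unit_cube R d)
      (fun x y => (\prod_k w (tnth x k) (tnth y k))
                  * \prod_k F k (tnth x k) (tnth y k)) (\prod_k v k).
  move=> F0 Fv.
  have := has_iterated_integral_prod (F := fun k x y => w x y * F k x y)
    (fun k x y x01 y01 => mulr_ge0 (w0 x y x01 y01) (F0 k x y x01 y01)) Fv.
  by apply: eq_has_iterated_integral => // x y _ _; rewrite big_split.
have KH : has_iterated_integral mu (unit_cube R d)
    (fun x y => \sum_(m in H) \sum_(n in H)
       (\prod_k w (tnth x k) (tnth y k)) * (arc_count m x y * arc_count n x y))
    (\sum_(m in H) \sum_(n in H)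
        \prod_k K (lattice_pt R (tnth m k)) (lattice_pt R (tnth n k))).
  apply: (has_iterated_integral_sum mcube) => m _.
  apply: (has_iterated_integral_sum mcube) => n _.
  have := prod_int (fun k x y => (arc_mem x y (lattice_pt R (tnth m k)))%:R
      * (arc_mem x y (lattice_pt R (tnth n k)))%:R) _
    (fun k x y _ _ => mulr_ge0 (ler0n _ _) (ler0n _ _))
    (fun k => Kw _ _ (lattice_pt_itv R (tnth m k))
                     (lattice_pt_itv R (tnth n k))).
  apply: eq_has_iterated_integral; first exact: mcube.
  by move=> x y _ _; rewrite big_split.
have sH : has_iterated_integral mu (unit_cube R d)
    (fun x y => \sum_(m in H) (\prod_k w (tnth x k) (tnth y k)) *
       (arc_count m x y * \prod_k arc_len (tnth x k) (tnth y k)))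
    (\sum_(m in H) \prod_k s (lattice_pt R (tnth m k))).
  apply: (has_iterated_integral_sum mcube) => m _.
  have := prod_int (fun k x y => (arc_mem x y (lattice_pt R (tnth m k)))%:R
      * arc_len x y) _
    (fun k x y x01 y01 => mulr_ge0 (ler0n _ _) (len0 x y x01 y01))
    (fun k => sw _ (lattice_pt_itv R (tnth m k))).
  apply: eq_has_iterated_integral; first exact: mcube.
  by move=> x y _ _; rewrite big_split.
have lH : has_iterated_integral mu (unit_cube R d)
    (fun x y => (\prod_k w (tnth x k) (tnth y k)) *
       \prod_k arc_len (tnth x k) (tnth y k) ^+ 2) (l ^+ d).
  rewrite -[in l ^+ d](card_ord d) -prodr_const.
  apply: (prod_int (fun k x y => arc_len x y ^+ 2)) => // k x y _ _.
  by rewrite sqr_ge0.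
have := has_iterated_integralD mcube KH (has_iterated_integralD mcube
  (has_iterated_integralZ mcube (- (2 * #|H|%:R)) sH)
  (has_iterated_integralZ mcube (#|H|%:R ^+ 2) lH)).
apply: eq_has_iterated_integral => // x y /set_mem x01 /set_mem y01.
rewrite discrepancy_latin_points// prodrXl.
have -> (W L : R) : \sum_(m in H) W * (arc_count m x y * L)
    = W * ((\sum_(m in H) arc_count m x y) * L).
  by rewrite mulr_suml mulr_sumr.
have -> (W : R) :
    \sum_(m in H) \sum_(n in H) W * (arc_count m x y * arc_count n x y)
    = W * (\sum_(m in H) arc_count m x y) ^+ 2.
  rewrite expr2 big_distrlr/= mulr_sumr; apply: eq_bigr => m _.
  by rewrite mulr_sumr.
by ring.
Qed.

End latin_discrepancy.

Section L2_as_iterated_integral.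
Variables (R : realType) (d : nat) (X : set 'RR[R]_d).
Let mu := lebesgue_tuple R d.

Lemma L2_per_sqr v :
  has_iterated_integral mu (unit_cube R d)
    (fun x y => discrepancy X x y ^+ 2) v ->
  L2_per X ^+ 2 = v.
Proof.
move=> Xv; rewrite /L2_per (has_iterated_integralE Xv)/= sqr_sqrtr//.
by apply: has_iterated_integral_ge0 Xv => x y _ _; rewrite sqr_ge0.
Qed.

(** The region above [x] is cut out of the cube by the indicators of
    [x_k < y_k]; the normalizing factors 2 multiply to [2 ^ d]. *)
Lemma L2_extr_sqr v :
  has_iterated_integral mu (unit_cube R d)
    (fun x y => (\prod_k (2 * ((tnth x k : R) < tnth y k)%R%:R))
                * discrepancy X x y ^+ 2) v ->
  2 ^+ d * L2_extr X ^+ 2 = v.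
Proof.
move=> Xv; have mcube := @measurable_unit_cube R d.
have pos : {in unit_cube R d &, forall x y : 'RR[R]_d,
    0 <= (\prod_k (2 * ((tnth x k : R) < tnth y k)%R%:R))
         * discrepancy X x y ^+ 2}.
  by move=> x y _ _; rewrite mulr_ge0 ?sqr_ge0// prodr_ge0.
have v0 := has_iterated_integral_ge0 pos Xv.
have := has_iterated_integralE (has_iterated_integralZ mcube (2 ^- d) Xv).
rewrite /L2_extr => Xv2; rewrite (_ : (\int[_]_(x in _) _)%E = (2 ^- d * v)%:E).
  by rewrite /= sqr_sqrtr ?mulr_ge0// mulVKf// expf_neq0.
rewrite -Xv2; apply: eq_integral => x x01.
rewrite [LHS]integral_mkcond [RHS]integral_mkcond; apply: eq_integral => y _.
rewrite !patchE; have [y01|yN01] := boolP (y \in unit_cube R d); last first.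
  by case: ifPn => // /set_mem[/mem_set]; rewrite (negPf yN01).
rewrite big_split/= prodr_const card_ord mulrA mulKf ?expf_neq0//.
case: ifPn => [/set_mem[_ xy]|/negP xyN].
  by rewrite big1 ?mul1r// => k _; rewrite xy.
have [k /negP/negPf kN] : exists k, ~ (tnth x k : R) < tnth y k.
  by apply/existsNP => xy; apply: xyN; apply/mem_set; split; [exact: set_mem|].
by rewrite (bigD1 k)//= kN !mul0r.
Qed.

End L2_as_iterated_integral.

(** * Evaluation of the two discrepancies *)

Section latin_evaluation.
Variables (R : realType) (M d : nat) (H : {set d.-tuple 'I_M}).
Hypotheses (M_gt0 : (0 < M)%N) (d_gt0 : (0 < d)%N).
Hypothesis latinH : weak_latin_hypercube H.

Local Notation pt m k := (lattice_pt R (tnth m k)).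
Local Notation N := (#|H|%:R : R).
Local Notation mu := (mean_gap R M).

(** The one part of both final values that depends on [H] beyond its size; being
    the same for both, it cancels in their difference. *)
Definition centred_pair_sum : R :=
  \sum_(m in H) \sum_(n in H) \prod_k (mu - gap (pt m k) (pt n k)).

Let centred_single_sum : R := \sum_(m in H) \prod_k (parabola (pt m k) - mu).

Let sum_const (c : R) : \sum_(j < M) c = M%:R * c.
Proof. by rewrite sumr_const card_ord mulr_natl. Qed.

Let sum_gap0 (j : 'I_M) :
  \sum_(i < M) (mu - gap (lattice_pt R i) (lattice_pt R j)) = 0.
Proof.
under eq_bigr do rewrite /gap distrC.
by rewrite sumrB sum_gap sum_const subrr.
Qed.

Let sum_gap0' (i : 'I_M) :
  \sum_(j < M) (mu - gap (lattice_pt R i) (lattice_pt R j)) = 0.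
Proof. by rewrite sumrB sum_gap sum_const subrr. Qed.

Let per_pair_sum :
  \sum_(m in H) \sum_(n in H)
    \prod_k (2^-1 - gap (pt m k) (pt n k))
  = centred_pair_sum + N ^+ 2 * (2^-1 - mu) ^+ d.
Proof.
have := sum2_latin_prod latinH M_gt0 d_gt0 (2^-1 - mu) (u := fun=> 0)
  (w := fun i j => mu - gap (lattice_pt R i) (lattice_pt R j))
  _ sum_gap0 sum_gap0'.
rewrite big1// => /(_ erefl).
rewrite [\sum_(m in H) \prod_k 0]big1 ?mulr0 ?addr0; last first.
  by move=> m _; rewrite (bigD1 (Ordinal d_gt0))//= mul0r.
move=> <-; apply: eq_bigr => m _; apply: eq_bigr => n _.
by apply: eq_bigr => k _; ring.
Qed.

Let extr_pair_sum :
  \sum_(m in H) \sum_(n in H) \prod_k (parabola (pt m k) + parabola (pt n k)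
    - gap (pt m k) (pt n k))
  = centred_pair_sum + 2 * N * centred_single_sum + N ^+ 2 * mu ^+ d.
Proof.
rewrite -(sum2_latin_prod latinH M_gt0 d_gt0 mu
  (u := fun j => parabola (lattice_pt R j) - mu)
  (w := fun i j => mu - gap (lattice_pt R i) (lattice_pt R j)))//.
  apply: eq_bigr => m _; apply: eq_bigr => n _.
  by apply: eq_bigr => k _; ring.
by rewrite sumrB sum_parabola// sum_const subrr.
Qed.

Let extr_single_sum :
  \sum_(m in H) \prod_k parabola (pt m k) = centred_single_sum + N * mu ^+ d.
Proof.
rewrite (sum_latin_prod latinH M_gt0 d_gt0
  (f := fun _ j => parabola (lattice_pt R j))
  (a := fun=> mu)) ?prodr_const ?card_ord//.
by move=> _; exact: sum_parabola.
Qed.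

Lemma L2_per_latin :
  L2_per (latin_points R H) ^+ 2 =
  centred_pair_sum + N ^+ 2 * ((2^-1 - mu) ^+ d - 3^-1 ^+ d).
Proof.
apply: L2_per_sqr; have mcube := @measurable_unit_cube R d.
have one (F : R -> R -> R) v :
    has_iterated_integral lebesgue_measure (itv01 R) F v ->
    has_iterated_integral lebesgue_measure (itv01 R) (fun x y => 1 * F x y) v.
  apply: eq_has_iterated_integral; first exact: measurable_itv01.
  by move=> x y _ _; rewrite mul1r.
have := has_iterated_integral_discrepancy H (w := fun=> fun=> 1)
  (K := fun p q => 2^-1 - gap p q) (s := fun=> 3^-1) (l := 3^-1)
  (fun _ _ _ _ => ler01) _ _ (one _ _ (per_length_sq R)).
have single : \sum_(m in H) \prod_(k < d) 3^-1 = N * 3^-1 ^+ d :> R.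
  by rewrite sumr_const prodr_const card_ord [RHS]mulr_natl.
rewrite per_pair_sum single => per_int.
have -> : centred_pair_sum + N ^+ 2 * ((2^-1 - mu) ^+ d - 3^-1 ^+ d) =
    centred_pair_sum + N ^+ 2 * (2^-1 - mu) ^+ d
    + (- (2 * N) * (N * 3^-1 ^+ d) + N ^+ 2 * 3^-1 ^+ d) by ring.
apply: eq_has_iterated_integral (per_int _ _); first exact: mcube.
- by move=> x y _ _; rewrite big1_eq mul1r.
- move=> p q /andP[p0 p1] /andP[q0 q1]; apply: one; exact: per_pair.
- by move=> p /andP[p0 p1]; apply: one; exact: per_single.
Qed.

Lemma L2_extr_latin :
  2 ^+ d * L2_extr (latin_points R H) ^+ 2 =
  centred_pair_sum + N ^+ 2 * (6^-1 ^+ d - mu ^+ d).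
Proof.
apply: L2_extr_sqr; have mcube := @measurable_unit_cube R d.
have w0 : {in itv01 R &, forall x y, 0 <= 2 * ((x : R) < y)%R%:R :> R}.
  by move=> x y _ _; rewrite mulr_ge0.
have := has_iterated_integral_discrepancy H
  (K := fun p q => parabola p + parabola q - gap p q)
  (s := fun p => parabola p) w0 _ _ (extr_length_sq R).
rewrite extr_pair_sum extr_single_sum => extr_int.
have -> : centred_pair_sum + N ^+ 2 * (6^-1 ^+ d - mu ^+ d) =
    centred_pair_sum + 2 * N * centred_single_sum + N ^+ 2 * mu ^+ d
    + (- (2 * N) * (centred_single_sum + N * mu ^+ d) + N ^+ 2 * 6^-1 ^+ d).
  by ring.
apply: extr_int.
- by move=> p q /andP[p0 p1] /andP[q0 q1]; exact: extr_pair.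
- by move=> p /andP[p0 p1]; exact: extr_single.
Qed.

End latin_evaluation.

Theorem theorem3p1 (R : realType) (M d : nat) (H : {set d.-tuple 'I_M})
    (M_ge1 : (1 <= M)%N) (d_ge2 : (2 <= d)%N)
    (latinH : weak_latin_hypercube H) :
  L2_per (latin_points R H) ^+ 2 - 2 ^+ d * L2_extr (latin_points R H) ^+ 2
  = ((2 * M%:R ^+ 2 + 1) ^+ d + (M%:R ^+ 2 - 1) ^+ d
       - (1 + 2 ^+ d) * M%:R ^+ (2 * d)) / (6 ^+ d * M%:R ^+ 2).
Proof.
have d_gt0 : (0 < d)%N := ltnW d_ge2.
rewrite (L2_per_latin R M_ge1 d_gt0 latinH).
rewrite (L2_extr_latin R M_ge1 d_gt0 latinH).
have M0 : M%:R != 0 :> R by rewrite pnatr_eq0 -lt0n.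
have -> : #|H|%:R = M%:R ^+ d / M%:R :> R.
  by rewrite -(card_latin R latinH d_gt0) mulrC mulKf.
have -> : 2^-1 - mean_gap R M = (2 * M%:R ^+ 2 + 1) / (6 * M%:R ^+ 2).
  by rewrite /mean_gap; field.
(* Every power is put over the common denominator 6 ^ d. *)
have -> : (3 : R)^-1 = 2 / 6 by field.
rewrite /mean_gap !expr_div_n !exprMn exprM exprVn (exprAC _ 2%N d).
by field; rewrite M0 !expf_neq0.
Qed.
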